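(* Let $(\mathcal{M},\theta)$ be a compact metric space with a Borel probability measure $\mu$, and suppose it is distance-invariant, i.e. for each $r\in T$ the value $\mu(B_r(y))$ is independent of $y\in\mathcal{M}$. Then for all $r\in T$ and $y_1,y_2\in\mathcal{M}$, $$\lambda_r(y_1,y_2)+\theta^\Delta_r(y_1,y_2)=\langle\theta^\Delta_r\rangle .$$ Moreover, let $\xi$ be any non-negative Borel measure on $T$ such that the integrals over $T$ defining $\lambda(\xi,y_1,y_2)$, $\lambda[\xi,\mathcal{D}_N]$, $\theta^\Delta(\xi,y_1,y_2)$ and $\langle\theta^\Delta(\xi)\rangle$ converge. Then for all $y_1,y_2\in\mathcal{M}$, $$\lambda(\xi,y_1,y_2)+\theta^\Delta(\xi,y_1,y_2)=\langle\theta^\Delta(\xi)\rangle ,$$ for every $N$-point subset $\mathcal{D}_N\subset\mathcal{M}$, $$\lambda[\xi,\mathcal{D}_N]+\theta^\Delta[\xi,\mathcal{D}_N]=\langle\theta^\Delta(\xi)\rangle N^2 ,$$ and for every integer $N\ge1$ such that $\mathcal{M}$ has at least $N$ points, $$\lambda_N(\xi)+\theta^\Delta_N(\xi)=\langle\theta^\Delta(\xi)\rangle N^2 .$$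
   Context: Set of radii: $T=\{\theta(y_1,y_2):y_1,y_2\in\mathcal{M}\}$. Balls: $B_r(y)=\{x\in\mathcal{M}:\theta(x,y)<r\}$. $\chi(\mathcal{E},\cdot)$ is the characteristic function of a set $\mathcal{E}$. Discrepancy kernels: $\Lambda(B_r(y),x)=\chi(B_r(y),x)-\mu(B_r(y))$; $\lambda_r(y_1,y_2)=\int_{\mathcal{M}}\Lambda(B_r(y),y_1)\Lambda(B_r(y),y_2)\,d\mu(y)$; $\lambda(\xi,y_1,y_2)=\int_T\lambda_r(y_1,y_2)\,d\xi(r)$. For an $N$-point subset $\mathcal{D}_N\subset\mathcal{M}$: $\lambda_r[\mathcal{D}_N]=\sum_{y_1,y_2\in\mathcal{D}_N}\lambda_r(y_1,y_2)$ and $\lambda[\xi,\mathcal{D}_N]=\int_T\lambda_r[\mathcal{D}_N]\,d\xi(r)=\sum_{y_1,y_2\in\mathcal{D}_N}\lambda(\xi,y_1,y_2)$; $\lambda_N(\xi)=\inf_{\mathcal{D}_N}\lambda[\xi,\mathcal{D}_N]$ over all $N$-point subsets. Symmetric difference metrics: $\theta^\Delta_r(y_1,y_2)=\tfrac12\mu(B_r(y_1)\Delta B_r(y_2))$ ($\Delta$ = symmetric difference of sets); $\theta^\Delta(\xi,y_1,y_2)=\int_T\theta^\Delta_r(y_1,y_2)\,d\xi(r)$; averages $\langle\theta^\Delta_r\rangle=\iint_{\mathcal{M}\times\mathcal{M}}\theta^\Delta_r(y_1,y_2)\,d\mu(y_1)d\mu(y_2)$ and $\langle\theta^\Delta(\xi)\rangle=\int_T\langle\theta^\Delta_r\rangle\,d\xi(r)$.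 $\theta^\Delta[\xi,\mathcal{D}_N]=\sum_{x_1,x_2\in\mathcal{D}_N}\theta^\Delta(\xi,x_1,x_2)$ and $\theta^\Delta_N(\xi)=\sup_{\mathcal{D}_N}\theta^\Delta[\xi,\mathcal{D}_N]$ over all $N$-point subsets. *)

(* Defs.v *)
From HB Require Import structures.
From mathcomp Require Import all_boot all_order all_algebra finmap.
From mathcomp Require Import all_classical all_reals all_analysis.

Set Implicit Arguments.
Unset Strict Implicit.
Unset Printing Implicit Defensive.

Import Order.TTheory GRing.Theory Num.Theory.

Local Open Scope classical_set_scope.
Local Open Scope ring_scope.

(* Measurable types carry a distinguished point, metric types do not. Asking
   for one loses nothing, as a space with a probability measure is nonempty. *)
#[short(type="pmetricType")]
HB.structure Definition PointedMetric (K : numDomainType) :=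
  { M of Metric K M & Pointed M }.

Notation borelType M := (g_sigma_algebraType (@open M)).

Section discrepancy.
Context {R : realType} {M : pmetricType R}.
Implicit Types (mu : probability (borelType M) R) (r : R) (x y : M).
Implicit Types (D : {fset M}) (N : nat).

Definition radii : set R := [set mdist p.1 p.2 | p in [set: M * M]].

Definition oball r y : set M := [set x | mdist x y < r].

Definition distance_invariant mu :=
  forall r, radii r -> forall y y', mu (oball r y) = mu (oball r y').

Definition Lambda mu (E : set M) x : R := \1_E x - fine (mu E).

Definition lambda mu r y1 y2 : R :=
  \int[mu]_y (Lambda mu (oball r y) y1 * Lambda mu (oball r y) y2).

Definition lambda_sum mu r D : R :=
  \sum_(y1 <- D) \sum_(y2 <- D) lambda mu r y1 y2.

Definition symdiff_metric mu r y1 y2 : R :=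
  2^-1 * fine (mu (oball r y1 `+` oball r y2)).

Definition symdiff_avg mu r : R :=
  \int[(mu \x mu)%E]_p symdiff_metric mu r p.1 p.2.

(* A Borel measure on [radii] is represented by a Borel measure on the line
   that is only ever integrated over [radii], a compact set when [M] is. *)
Implicit Type xi : {measure set (measurableTypeR R) -> \bar R}.

Definition lambda_int mu xi y1 y2 : R :=
  \int[xi]_(r in radii) lambda mu r y1 y2.

Definition lambda_int_sum mu xi D : R :=
  \int[xi]_(r in radii) lambda_sum mu r D.

Definition symdiff_metric_int mu xi y1 y2 : R :=
  \int[xi]_(r in radii) symdiff_metric mu r y1 y2.

Definition symdiff_avg_int mu xi : R :=
  \int[xi]_(r in radii) symdiff_avg mu r.

Definition symdiff_metric_int_sum mu xi D : R :=
  \sum_(x1 <- D) \sum_(x2 <- D) symdiff_metric_int mu xi x1 x2.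

Definition integrals_converge mu xi :=
  [/\ forall y1 y2, xi.-integrable radii (fun r => (lambda mu r y1 y2)%:E),
      forall D, xi.-integrable radii (fun r => (lambda_sum mu r D)%:E),
      forall y1 y2,
        xi.-integrable radii (fun r => (symdiff_metric mu r y1 y2)%:E)
    & xi.-integrable radii (fun r => (symdiff_avg mu r)%:E)].

(* The extrema are taken in the extended reals because [inf] and [sup] in [R]
   return 0 on unbounded sets. *)
Definition lambda_inf mu xi N : \bar R :=
  ereal_inf [set (lambda_int_sum mu xi D)%:E | D in [set D | #|` D| = N]].

Definition symdiff_metric_sup mu xi N : \bar R :=
  ereal_sup
    [set (symdiff_metric_int_sum mu xi D)%:E | D in [set D | #|` D| = N]].

End discrepancy.

Arguments radii {R} M.

(* Main.v *)
(* If all balls of radius r have measure c, then expanding the kernel gives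
   lambda_r(y1, y2) = mu(B_r(y1) `&` B_r(y2)) - c^2, while
   theta_r(y1, y2) = c - mu(B_r(y1) `&` B_r(y2)), so that the sum is c - c^2.
   By Fubini the average of mu(B_r(y1) `&` B_r(y2)) over y1, y2 is the integral
   over y of mu(B_r(y))^2 = c^2, so c - c^2 is also the average of theta_r.
   Everything else follows by linearity; in the last identity the infimum is
   finite because lambda_r[D] is the integral over y of the square of
   \sum_(x in D) Lambda(B_r(y), x). *)

Require Import Defs.
From HB Require Import structures.
From mathcomp Require Import all_boot all_order all_algebra finmap ring lra.
From mathcomp Require Import all_classical all_reals all_analysis.

Set Implicit Arguments.
Unset Strict Implicit.
Unset Printing Implicit Defensive.

Import Order.TTheory GRing.Theory Num.Theory.

Local Open Scope classical_set_scope.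
Local Open Scope ring_scope.

(** * Measurability of balls, of the relation [mdist x y < r], and of the radii *)

Lemma open_oball {R : realType} {M : pmetricType R} (r : R) (y : M) :
  open (oball r y).
Proof.
rewrite openE => x /= xy; apply/nbhs_ballP; exists (r - mdist x y).
  by rewrite /= subr_gt0.
move=> z; rewrite ballEmdist /= ltrBrDr => xz.
by rewrite /oball/= (le_lt_trans (metric_triangle _ x _))// (metric_sym z x).
Qed.

Lemma measurable_oball {R : realType} {M : pmetricType R} (r : R) (y : M) :
  measurable (oball r y : set (borelType M)).
Proof. by apply: sub_sigma_algebra; exact: open_oball. Qed.

(* Without second countability the Borel sets of the product could exceed the
   product sigma-algebra; compactness gives a finite 1/n-net for each n, which
   writes the set as a countable union of rectangles. *)
Lemma measurable_mdist_lt {R : realType} {M : pmetricType R} (r : R) :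
  compact [set: M] ->
  measurable [set p : borelType M * borelType M | mdist (p.1 : M) p.2 < r].
Proof.
rewrite compact_cover => compactM.
have net (n : nat) : exists S : {fset M},
    forall x, exists2 s, s \in S & mdist x s < n.+1%:R^-1.
  have [|x _|S _ MS] := compactM M setT (oball n.+1%:R^-1).
  - by move=> s _; exact: open_oball.
  - by exists x => //; rewrite /oball/= mdistxx invr_gt0.
  by exists S => x; have [s sS xs] := MS x I; exists s.
have [S SP] := choice net.
rewrite (_ : mkset _ = \bigcup_n \bigcup_(s in [set` S n])
    (oball n.+1%:R^-1 s `*` oball (r - n.+1%:R^-1) s)).
  apply: bigcupT_measurable => n; apply: fin_bigcup_measurable => // s _.
  by apply: measurableX; exact: measurable_oball.
apply/seteqP; split => [[x y]/= xy|[x y] [n _ [s /= sS []]]/=]; last first.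
  rewrite /oball/= => xs ys.
  rewrite (le_lt_trans (metric_triangle _ s _))// (metric_sym s).
  by rewrite -(subrKC n.+1%:R^-1 r) ltrD.
(* The gap [r - mdist x y] must absorb [n.+1%:R^-1] twice: once for replacing [x] by the net point
   [s], once for the smaller radius of the second ball. *)
have d0 : 0 < (r - mdist (x : M) y) / 2 by rewrite divr_gt0// subr_gt0.
have [n _ /(_ n (leqnn n)) /= nd] := near_infty_natSinv_lt (PosNum d0).
exists n => //; have [s sS xs] := SP n x; exists s => //; split => //=.
rewrite /oball/= (le_lt_trans (metric_triangle _ x _))// (metric_sym _ x).
have := ltrD nd nd; rewrite /= -splitr => qq.
by rewrite ltrBrDr -addrA -ltrBrDl (lt_trans _ qq)// ltrD2r.
Qed.

(** The distance is continuous on the compact square of [M], so its image is a compact subset of the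
    line. Additivity of integrals over [radii M] relies on this. *)
Lemma measurable_radii (R : realType) (M : pmetricType R) :
  compact [set: M] -> measurable (radii M).
Proof.
move=> compactM; apply: measurable_realfun.compact_measurable.
have := compact_setX compactM compactM; rewrite setXTT => /continuous_compact.
apply; apply: continuous_subspaceT => -[x y] /=.
apply/cvgrPdist_lt => /= e e0.
have e20 : 0 < e / 2 by rewrite divr_gt0.
exists (ball x (e / 2), ball y (e / 2)); first by split; exact: nbhsx_ballx.
move=> [x' y'] /= []; rewrite !ballEmdist /= => xx' yy'.
(* One-sided bound, general in the four points: exchanging the two pairs yields the other side. *)
have H (a b a' b' : M) : mdist a a' < e / 2 -> mdist b b' < e / 2 ->
    mdist a b < mdist a' b' + e.
  move=> aa' bb'; rewrite (le_lt_trans (metric_triangle _ a' _))//.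
  have := metric_triangle a' b' b; rewrite (metric_sym b' b); lra.
by rewrite ltr_distl ltrBlDr !H// metric_sym.
Qed.

(** * Real-valued integrals of indicators and finite sums *)

Lemma Rintegral_indic d (T : measurableType d) (R : realType)
    (mu : {measure set T -> \bar R}) (A : set T) :
  measurable A -> \int[mu]_x \1_A x = fine (mu A).
Proof. by move=> mA; rewrite /Rintegral integral_indic// setIT. Qed.

Section Rintegral_sum.
Context d (T : measurableType d) (R : realType).
Context (mu : {measure set T -> \bar R}) (A : set T) (I : Type) (f : I -> T -> R).
Context (mA : measurable A).
Context (intf : forall i, mu.-integrable A (EFin \o f i)).

Lemma integrable_sum_EFin (s : seq I) :
  mu.-integrable A (EFin \o (fun x => \sum_(i <- s) f i x)).
Proof.
rewrite [_ \o _](_ : _ = fun x => (\sum_(i <- s) (f i x)%:E)%E).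
  by apply: integrable_sum => // i _; exact: intf.
by apply/funext => x; rewrite /= sumEFin.
Qed.

Lemma Rintegral_sum (s : seq I) :
  \int[mu]_(x in A) \sum_(i <- s) f i x = \sum_(i <- s) \int[mu]_(x in A) f i x.
Proof.
elim: s => [|i s IHs].
  under eq_Rintegral do rewrite big_nil.
  by rewrite big_nil Rintegral_cst// mul0r.
under eq_Rintegral do rewrite big_cons.
by rewrite big_cons RintegralD// ?IHs//; exact: integrable_sum_EFin.
Qed.

End Rintegral_sum.

(** * The identity for one radius whose balls all have measure [c] *)

Section fixed_radius.
Context {R : realType} {M : pmetricType R} (mu : probability (borelType M) R).
Context (r c : R) (muE : forall y, mu (oball r y) = c%:E).

Let integrable_oballI y1 y2 :
  mu.-integrable setT (EFin \o \1_(oball r y1 `&` oball r y2)).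
Proof.
by apply: integrable_indic; apply: measurableI; exact: measurable_oball.
Qed.

Let integrable_oball y :
  mu.-integrable setT (EFin \o \1_(oball r y)).
Proof. by rewrite -(setIid (oball r y)). Qed.

Let Rintegral_oball y : \int[mu]_z \1_(oball r y) z = c.
Proof.
rewrite Rintegral_indic; last exact: measurable_oball.
by rewrite [X in fine X](muE y).
Qed.

(** By symmetry of the distance, centre and point can be exchanged, so that as a function of the
    centre [y] the kernel is a ball indicator minus a constant. *)
Lemma Lambda_oball x y :
  Lambda mu (oball r y) x = \1_(oball r x) y - c.
Proof.
rewrite /Lambda muE /= !indicE; congr (_%:R - _); congr nat_of_bool.
by apply/idP/idP; rewrite !inE /oball /= metric_sym.
Qed.

Lemma integrable_Lambda x :
  mu.-integrable setT (EFin \o (fun y => Lambda mu (oball r y) x)).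
Proof.
rewrite (_ : _ \o _ = (EFin \o \1_(oball r x)) \- (EFin \o cst c))%E.
  by apply: integrableB => //; exact: finite_measure_integrable_cst.
by apply/funext => y; rewrite /= Lambda_oball.
Qed.

Lemma Rintegral_Lambda x : \int[mu]_y Lambda mu (oball r y) x = 0.
Proof.
transitivity (\int[mu]_y (\1_(oball r x) y - cst c y)).
  by apply: eq_Rintegral => y _; rewrite Lambda_oball.
rewrite RintegralB//; last exact: finite_measure_integrable_cst.
rewrite Rintegral_oball Rintegral_cst// [X in _ * fine X](probability_setT mu).
by rewrite mulr1 subrr.
Qed.

(** The last factor is deliberately left unexpanded: its integral vanishes by [Rintegral_Lambda]. *)
Lemma Lambda_mulE x1 x2 y :
  Lambda mu (oball r y) x1 * Lambda mu (oball r y) x2 =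
  \1_(oball r x1 `&` oball r x2) y - c * \1_(oball r x1) y
  - c * Lambda mu (oball r y) x2.
Proof. by rewrite !Lambda_oball indicI /=; ring. Qed.

Lemma integrable_Lambda_mul x1 x2 : mu.-integrable setT
  (EFin \o (fun y => Lambda mu (oball r y) x1 * Lambda mu (oball r y) x2)).
Proof.
rewrite [X in _ \o X](_ : _ = fun y => \1_(oball r x1 `&` oball r x2) y
    - c * (\1_(oball r x1) y + Lambda mu (oball r y) x2)); last first.
  by apply/funext => y; rewrite Lambda_mulE; ring.
exact: (integrableB _ (integrable_oballI x1 x2) (integrableZl _ c
  (integrableD _ (integrable_oball x1) (integrable_Lambda x2)))).
Qed.

Lemma lambdaE y1 y2 :
  lambda mu r y1 y2 = fine (mu (oball r y1 `&` oball r y2)) - c ^+ 2.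
Proof.
rewrite /lambda.
transitivity (\int[mu]_y (\1_(oball r y1 `&` oball r y2) y
  - (c * (\1_(oball r y1) y + Lambda mu (oball r y) y2)))).
  by apply: eq_Rintegral => y _; rewrite Lambda_mulE; ring.
have iL := integrable_Lambda y2.
have iDL := integrableD measurableT (integrable_oball y1) iL.
rewrite RintegralB//; last exact: (integrableZl _ c iDL).
rewrite RintegralZl// RintegralD// Rintegral_Lambda Rintegral_oball.
rewrite Rintegral_indic; first by rewrite addr0 expr2.
by apply: measurableI; exact: measurable_oball.
Qed.

(** The symmetric difference splits into two disjoint differences, each of measure [c] minus that of
    the intersection; the factor one half cancels the doubling. *)
Lemma symdiff_metricE y1 y2 :
  symdiff_metric mu r y1 y2 = c - fine (mu (oball r y1 `&` oball r y2)).
Proof.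
have mE y : measurable (oball r y : set (borelType M)).
  exact: measurable_oball.
rewrite /symdiff_metric setY_def measureU; last first.
- by apply/seteqP; split => // x [[_ +] [+ _]].
- exact: measurableD.
- exact: measurableD.
have muI : mu (oball r y1 `&` oball r y2) \is a fin_num.
  by apply: fin_num_measure; exact: measurableI.
rewrite !measureD//; [|by rewrite [ltLHS]muE ltry..].
set v := fine (mu (_ `&` _)).
transitivity (2^-1 * fine ((c%:E - v%:E) + (c%:E - v%:E))%E); last first.
  by rewrite -EFinB -EFinD /=; lra.
by congr (_ * fine (_ - _ + (_ - _))%E); [exact: muE|exact/esym/fineK|
  exact: muE|rewrite setIC; exact/esym/fineK].
Qed.

Lemma symdiff_avgE : compact [set: M] -> symdiff_avg mu r = c - c ^+ 2.
Proof.
move=> /(measurable_mdist_lt r) mD.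
(* Triples [((y1, y2), y)] with [y] in both balls. Fixing [(y1, y2)] leaves the intersection of the
   balls; fixing [y] leaves the square of the ball around [y], of product measure [c * c]. *)
pose S := [set q : (borelType M * borelType M) * borelType M |
  mdist (q.1.1 : M) q.2 < r /\ mdist (q.1.2 : M) q.2 < r].
have mS : measurable S.
  pose pr1 (q : (borelType M * borelType M) * borelType M) := (q.1.1, q.2).
  pose pr2 (q : (borelType M * borelType M) * borelType M) := (q.1.2, q.2).
  have mpr1 : measurable_fun setT pr1.
    by apply: measurable_fun_pair => //; exact: measurableT_comp.
  have mpr2 : measurable_fun setT pr2.
    by apply: measurable_fun_pair => //; exact: measurableT_comp.
  have := measurableI _ _ (mpr1 measurableT _ mD) (mpr2 measurableT _ mD).
  by rewrite !setTI.
have xS p : xsection S p = oball r p.1 `&` oball r p.2.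
  apply/seteqP; split => x; rewrite /xsection /= inE /S /oball /=.
    by rewrite !(metric_sym x).
  by rewrite !(metric_sym x).
have yS y : ysection S y = oball r y `*` oball r y.
  by apply/seteqP; split => x; rewrite /ysection /= inE /S /oball.
have intS : (\int[mu \x mu]_p mu (xsection S p) = (c * c)%:E)%E.
  have := indic_fubini_tonelli ((mu \x mu)%E : probability _ R) mu mS.
  rewrite indic_fubini_tonelli_FE// indic_fubini_tonelli_GE//= => ->.
  transitivity (\int[mu]_y (c * c)%:E)%E; last first.
    by rewrite integral_cst// -[RHS]mule1; congr (_ * _)%E;
      exact: probability_setT.
  apply: eq_integral => y _; rewrite /= yS EFinM -(muE y).
  by apply: product_measure1E; exact: measurable_oball.
(* The integrand is nonnegative, so integrability follows from the finite value in [intS]. *)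
have iS : (mu \x mu)%E.-integrable setT
    (EFin \o fun p => fine (mu (xsection S p))).
  apply: (eq_integrable measurableT (mu \o xsection S)) => [p _|].
    by rewrite /= fineK// fin_num_measure//; exact: measurable_xsection.
  apply/integrableP; split; first exact: measurable_fun_xsection.
  by under eq_integral do rewrite /= gee0_abs//; rewrite intS ltry.
rewrite /symdiff_avg.
transitivity (\int[(mu \x mu)%E]_p (c - fine (mu (xsection S p)))).
  by apply: eq_Rintegral => p _; rewrite symdiff_metricE xS.
rewrite (@RintegralB _ _ _ _ _ (cst c))//; last first.
  exact: (finite_measure_integrable_cst ((mu \x mu)%E : probability _ R)).
rewrite Rintegral_cst//; congr (_ - _).
  rewrite [X in _ * fine X](probability_setT ((mu \x mu)%E : probability _ R)).
  exact: mulr1.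
rewrite expr2 -[RHS]/(fine (c * c)%:E) -intS; congr fine.
by apply: eq_integral => p _; rewrite fineK// fin_num_measure//;
  exact: measurable_xsection.
Qed.

Lemma lambda_sum_ge0 D : 0 <= lambda_sum mu r D.
Proof.
suff ->: lambda_sum mu r D =
    \int[mu]_y (\sum_(x <- D) Lambda mu (oball r y) x) ^+ 2.
  by apply: Rintegral_ge0 => y _; exact: sqr_ge0.
pose F x1 x2 y := Lambda mu (oball r y) x1 * Lambda mu (oball r y) x2.
transitivity (\int[mu]_y \sum_(x1 <- D) \sum_(x2 <- D) F x1 x2 y).
  rewrite Rintegral_sum// => [|x1].
    apply: eq_bigr => x1 _; rewrite Rintegral_sum// => x2.
    exact: integrable_Lambda_mul.
  by apply: integrable_sum_EFin => // x2; exact: integrable_Lambda_mul.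
apply: eq_Rintegral => y _; rewrite expr2 mulr_suml.
by apply: eq_bigr => x1 _; rewrite mulr_sumr.
Qed.

Lemma Stolarsky y1 y2 : compact [set: M] ->
  lambda mu r y1 y2 + symdiff_metric mu r y1 y2 = symdiff_avg mu r.
Proof.
by move=> cM; rewrite lambdaE symdiff_metricE symdiff_avgE// addrC subrKA.
Qed.

End fixed_radius.

(** On [S] one has [g = C - f], and reflection turns the infimum into a supremum. Nonnegativity of
    [f] and a point of [S] make the infimum finite, so it may be moved across inequalities in the
    extended reals. *)
Lemma ereal_inf_sup (R : realType) (T : Type) (S : set T) (f g : T -> R)
    (C : R) :
  S !=set0 -> (forall x, S x -> 0 <= f x) -> (forall x, S x -> f x + g x = C) ->
  (ereal_inf [set (f x)%:E | x in S] + ereal_sup [set (g x)%:E | x in S]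
   = C%:E)%E.
Proof.
move=> [x0 Sx0] f0 fg.
have ->: [set (g x)%:E | x in S] = [set (C - f x)%:E | x in S].
  by apply: eq_imagel => x Sx; rewrite -(fg x Sx) addrC addKr.
set m := ereal_inf _.
have m_ge0 : (0 <= m)%E by apply/ereal_infP => _ [x Sx <-]; rewrite lee_fin f0.
have m_le x : S x -> (m <= (f x)%:E)%E.
  by move=> Sx; apply: ereal_inf_lbound; exists x.
have m_fin : m \is a fin_num.
  by rewrite ge0_fin_numE// (le_lt_trans (m_le _ Sx0))// ltry.
suff -> : ereal_sup [set (C - f x)%:E | x in S] = (C%:E - m)%E.
  by rewrite addeC subeK.
apply/eqP; rewrite eq_le; apply/andP; split.
  apply/ereal_supP => _ [x Sx <-]; rewrite EFinB leeB//; exact: m_le.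
rewrite leeBlDr//; set s := ereal_sup _.
have le_s x : S x -> ((C - f x)%:E <= s)%E.
  by move=> Sx; apply: ereal_sup_ubound; exists x.
have : (-oo < s)%E by rewrite (lt_le_trans _ (le_s _ Sx0))// ltNyr.
(* The value [+oo] is harmless since [m] is finite; for a real [s], the claim says that [C - s] is a
   lower bound of [f]. *)
case: s le_s => [s le_s _|_ _|//]; last first.
  by rewrite addye ?leey// gt_eqF// ltNye_eq m_fin.
rewrite -leeBlDl//; apply/ereal_infP => _ [x Sx <-].
by rewrite leeBlDl// -leeBlDr// -EFinB le_s.
Qed.

(** * Integration over the radii and summation over finite point sets *)

Section fixed_measure.
Context {R : realType} {M : pmetricType R} (mu : probability (borelType M) R).
Context (compactM : compact [set: M]) (invM : distance_invariant mu).

(** Provides the constant [c] required for a fixed radius, read off at the ball around [point]. *)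
Lemma invariant_muE r : radii M r ->
  forall y, mu (oball r y) = (fine (mu (oball r point)))%:E.
Proof.
move=> rM y; rewrite fineK ?fin_num_measure//; last exact: measurable_oball.
exact: invM.
Qed.

Context (xi : {measure set (measurableTypeR R) -> \bar R}).
Context (cvg_xi : integrals_converge mu xi).

Let mT : measurable (radii M : set (measurableTypeR R)).
Proof. exact: measurable_radii. Qed.

Lemma Stolarsky_int y1 y2 :
  lambda_int mu xi y1 y2 + symdiff_metric_int mu xi y1 y2
  = symdiff_avg_int mu xi.
Proof.
case: cvg_xi => il _ is' _; rewrite /lambda_int /symdiff_metric_int -RintegralD//.
- apply: eq_Rintegral => r; rewrite inE => rM.
  exact: Stolarsky (invariant_muE rM) _ _ compactM.
- exact: il.
- exact: is'.
Qed.

Lemma Stolarsky_int_sum (D : {fset M}) :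
  lambda_int_sum mu xi D + symdiff_metric_int_sum mu xi D
  = symdiff_avg_int mu xi * #|` D|%:R ^+ 2.
Proof.
case: cvg_xi => il _ _ _.
(* Both sums leave the integral, so that [Stolarsky_int] applies to each pair of points
   separately. *)
have -> : lambda_int_sum mu xi D =
    \sum_(y1 <- D) \sum_(y2 <- D) lambda_int mu xi y1 y2.
  rewrite /lambda_int_sum Rintegral_sum// => [|y1].
    by apply: eq_bigr => y1 _; rewrite Rintegral_sum// => y2; exact: il.
  by apply: integrable_sum_EFin => // y2; exact: il.
have big_const c : \sum_(y <- D) c = c * #|` D|%:R :> R.
  by rewrite big_const_seq count_predT iter_addr_0 mulr_natr.
rewrite -big_split/= expr2 mulrA -[RHS]big_const.
apply: eq_bigr => y1 _; rewrite -big_split/= -big_const.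
by apply: eq_bigr => y2 _; exact: Stolarsky_int.
Qed.

Lemma lambda_int_sum_ge0 D : 0 <= lambda_int_sum mu xi D.
Proof.
by apply: Rintegral_ge0 => r rM; exact: (lambda_sum_ge0 (invariant_muE rM)).
Qed.

End fixed_measure.

(** Ensures that the infimum and supremum over [N]-point sets range over a nonempty family. *)
Lemma card_le_fset (T : pointedType) N :
  (`I_N #<= [set: T])%card -> exists D : {fset T}, #|` D| = N.
Proof.
move=> /pcard_injP[f inj_f]; exists [fset f (val i) | i in 'I_N]%fset.
rewrite card_imfset//= ?size_enum_ord// => i j fij.
by apply/val_inj/inj_f; rewrite ?inE/=.
Qed.

Theorem theorem2p1 (R : realType) (M : pmetricType R)
    (mu : probability (borelType M) R)
    (compactM : compact [set: M]) (invM : distance_invariant mu) :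
  (forall (r : R) (y1 y2 : M), radii M r ->
     lambda mu r y1 y2 + symdiff_metric mu r y1 y2 = symdiff_avg mu r) /\
  (forall xi : {measure set (measurableTypeR R) -> \bar R},
     integrals_converge mu xi ->
     [/\ forall y1 y2 : M,
           lambda_int mu xi y1 y2 + symdiff_metric_int mu xi y1 y2
           = symdiff_avg_int mu xi,
         forall (N : nat) (D : {fset M}), #|` D| = N ->
           lambda_int_sum mu xi D + symdiff_metric_int_sum mu xi D
           = symdiff_avg_int mu xi * N%:R ^+ 2
       & forall N : nat, (1 <= N)%N -> (`I_N #<= [set: M])%card ->
           (lambda_inf mu xi N + symdiff_metric_sup mu xi N
            = (symdiff_avg_int mu xi * N%:R ^+ 2)%:E)%E]).
Proof.
split=> [r y1 y2 rM|xi cvg_xi].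
  exact: Stolarsky (invariant_muE invM rM) _ _ compactM.
split=> [y1 y2|N D <-|N _ leNM].
- exact: Stolarsky_int.
- exact: Stolarsky_int_sum.
have [D DN] := card_le_fset leNM.
apply: ereal_inf_sup => [|E _|E /= <-]; first by exists D.
- exact: lambda_int_sum_ge0.
- exact: Stolarsky_int_sum.
Qed.
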